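(* Let $\Gamma$ be a finite group and let $\mathrm{Cay}(\Gamma,S)$ be a normal mixed Cayley graph (so $S\subseteq\Gamma\setminus\{\mathbf 1\}$ is a union of conjugacy classes of $\Gamma$). Let $\overline{S}=\{u\in S: u^{-1}\notin S\}$. Then $\mathrm{Cay}(\Gamma,S)$ is H-integral if and only if $S\setminus\overline{S}\in\mathbb{B}(\Gamma)$ and $\overline{S}\in\mathbb{D}(\Gamma)$.
   Context: $\Gamma$ is a finite group with identity $\mathbf 1$, and $S\subseteq \Gamma$ with $\mathbf 1\notin S$. The mixed Cayley graph $\mathrm{Cay}(\Gamma,S)$ has vertex set $\Gamma$ and edge set $E=\{(a,b): a,b\in\Gamma,\ ba^{-1}\in S\}$ (a set of ordered pairs). It is called normal if $S$ is a union of conjugacy classes of $\Gamma$. The Hermitian-adjacency matrix $(h_{uv})_{u,v\in\Gamma}$ has $h_{uv}=1$ if $(u,v)\in E$ and $(v,u)\in E$; $h_{uv}=\mathbf i=\sqrt{-1}$ if $(u,v)\in E$ and $(v,u)\notin E$; $h_{uv}=-\mathbf i$ if $(u,v)\notin E$ and $(v,u)\in E$; and $h_{uv}=0$ otherwise. The graph is H-integral if all eigenvalues of this matrix are integers. $\mathbb{B}(\Gamma)$ is the Boolean algebra of subsets of $\Gamma$ generated by the subgroups of $\Gamma$ (all sets obtained from subgroups by unions, intersections and complements). $\Gamma(4)=\{x\in\Gamma: \mathrm{ord}(x)\equiv 0 \pmod 4\}$. On $\Gamma(4)$ define the equivalence relation $x\approx y$ if and only if $y=x^k$ for some integer $k$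 with $\gcd(k,\mathrm{ord}(x))=1$ and $k\equiv 1\pmod 4$; let $\llbracket x\rrbracket$ be the equivalence class of $x$. A subset $A\subseteq\Gamma$ is skew-symmetric if $a^{-1}\notin A$ for all $a\in A$. $\mathbb{D}(\Gamma)$ is the class of all skew-symmetric subsets of $\Gamma$ that are unions of (finitely many, possibly zero) classes $\llbracket x\rrbracket$ with $x\in\Gamma(4)$; if $\Gamma(4)=\emptyset$ then $\mathbb{D}(\Gamma)=\{\emptyset\}$. *)

(* Defs.v *)
From mathcomp Require Import all_boot all_order all_fingroup all_algebra all_field.

Set Implicit Arguments.
Unset Strict Implicit.
Unset Printing Implicit Defensive.

Import GroupScope GRing.Theory Num.Theory.

Local Open Scope ring_scope.

(* A mixed graph on T is given by its set of directed edges e : rel T; an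
   undirected edge is a pair of opposite directed edges. *)
Section MixedGraph.

Variables (T : finType) (e : rel T).

Definition hermitian_entry (u v : T) : algC :=
  if e u v && e v u then 1
  else if e u v && ~~ e v u then 'i
  else if ~~ e u v && e v u then - 'i
  else 0.

(* Vertices are numbered by enum_val; renumbering them conjugates the matrix
   by a permutation matrix. *)
Definition hermitian_adjacency : 'M[algC]_#|T| :=
  \matrix_(i, j) hermitian_entry (enum_val i) (enum_val j).

(* The entries are Gaussian integers, so every complex eigenvalue is algebraic
   and nothing is lost by working over algC. *)
Definition H_integral : Prop :=
  forall a : algC, eigenvalue hermitian_adjacency a -> a \in Num.int.

End MixedGraph.

Section Groups.

Variable gT : finGroupType.
Implicit Types (S A B : {set gT}) (x y : gT).

Definition cayley_edge S : rel gT := fun a b => (b * a^-1)%g \in S.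

Definition union_of_conjugacy_classes S : Prop :=
  exists X : {set gT}, S = \bigcup_(x in X) (x ^: [set: gT])%g.

Definition oriented_part S : {set gT} := [set u in S | (u^-1)%g \notin S].

Inductive in_boolean_algebra : {set gT} -> Prop :=
  | BA_subgroup (H : {group gT}) : in_boolean_algebra H
  | BA_setU A B :
      in_boolean_algebra A -> in_boolean_algebra B -> in_boolean_algebra (A :|: B)
  | BA_setI A B :
      in_boolean_algebra A -> in_boolean_algebra B -> in_boolean_algebra (A :&: B)
  | BA_setC A : in_boolean_algebra A -> in_boolean_algebra (~: A).

Definition Gamma4 : {set gT} := [set x | (4 %| #[x]%g)%N].

Definition expgz x (k : int) : gT :=
  match k with Posz n => (x ^+ n)%g | Negz n => (x ^- n.+1)%g end.

Definition approx4 x y : Prop :=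
  [/\ x \in Gamma4, y \in Gamma4 &
      exists k : int,
        [/\ y = expgz x k, gcdz k (#[x]%g)%:Z = 1 & (k = 1 %[mod 4])%Z]].

Definition skew_symmetric A : Prop := forall a, a \in A -> (a^-1)%g \notin A.

(* A is the union of the approx4-classes of the elements of X. *)
Definition union_of_approx4_classes A : Prop :=
  exists2 X : {set gT}, X \subset Gamma4 &
    forall y, y \in A <-> (exists2 x, x \in X & approx4 x y).

Definition in_D A : Prop := skew_symmetric A /\ union_of_approx4_classes A.

End Groups.

(* Main.v *)
From HB Require Import structures.
Require Import Defs.
From mathcomp Require Import all_boot all_order all_fingroup all_algebra all_field.
From mathcomp Require Import all_solvable all_character.
From mathcomp Require Import ring zify.

(** Let [F : gT -> algC] take the values 1, 'i, -'i, 0 according to whether [x] and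
    [x^-1], only [x], only [x^-1], or neither belong to [S]. The adjacency matrix
    of Cay(G, S) has entries [F (v * u^-1)], so it is the matrix of convolution
    by [F], and [F] is a class function because [S] is normal.

    Eigenvalues. Expanding [F] over the irreducible characters, the generalized
    orthogonality relation shows that convolution by [F] scales each 'chi_i by
    lambda_i = #|G| * '[F, 'chi_i] / 'chi_i 1, and decomposing the regular
    character shows that there are no other eigenvalues
    ([eigenvalue_convolution]).

    Integrality. As [F] takes algebraic integer values, so do the central
    characters lambda_i, which are therefore integers as soon as they are
    rational, that is, fixed by every automorphism [u] of the field algC. Such a
    [u] raises the N-th roots of unity to some power [k] prime to [N]; when [N] is
    a multiple of #|G| this gives u ('chi_i x) = 'chi_i (x ^+ k). Hence all the
    lambda_i are integers if and only if F (x ^+ k) = u (F x) for all such [u],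
    [k] and all [x] ([conv_eigenvalue_intP]).

    Back to [S]. Take N = 4 * #|G|, so that 'i is also an N-th root of unity. If
    k = 1 modulo 4 then [u] fixes 'i, hence every value of [F], and the condition
    says that [S] is stable under [x |-> x ^+ k]. The case k = 3 modulo 4 follows
    on replacing [x] by [x^-1]. So H-integrality means that [S] is stable under
    all powers [k] prime to [N] with k = 1 modulo 4 ([power_stable_connection]).

    Finally [power_stableP] identifies these sets [S]. On the inverse-closed part
    of [S] the condition on [k] modulo 4 disappears, and stability means closure
    under generating the same cyclic group, which characterizes the members of
    the Boolean algebra ([in_boolean_algebraP]). On the oriented part the orbits
    of the power maps are the classes of [approx4]; the elements whose order is
    not a multiple of 4 are excluded because some power of the allowed kind
    inverts them ([inverse_exponent]). *)

Set Implicit Arguments.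
Unset Strict Implicit.
Unset Printing Implicit Defensive.

Import Order.TTheory GroupScope GRing.Theory Num.Theory.

Local Open Scope ring_scope.

(** * Residues prime to the modulus, and automorphisms of the algebraic numbers *)

(** For [N] a multiple of [m], this is the surjectivity of the reduction from the
    units modulo [N] to those modulo [m]. The lift adds to a positive
    representative [h] of [k] a multiple of [m] whose prime factors include every
    prime factor of [N] that does not divide [h], and no prime factor of [h]. *)
Lemma coprime_lift (k m N : nat) :
    (0 < N)%N -> coprime k m ->
  exists2 k' : nat, coprime k' N & k' = k %[mod m].
Proof.
move=> N_gt0 co_km.
(* Adding [m] to [k] makes it positive, as its set of prime divisors requires. *)
have [h [h_gt0 co_hm <-]] : exists h, [/\ (0 < h)%N, coprime h m & h = k %[mod m]].
  exists (k + m)%N; rewrite modnDr /coprime gcdnC gcdnDr gcdnC; split=> //.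
  by rewrite addn_gt0; case: k m co_km => [|?] [].
set t := (N`_(\pi(h)^'))%N.
have co_ht: coprime h t by rewrite coprime_pi' ?part_gt0 // part_pnat.
exists (m * t + h)%N; last by rewrite mulnC modnMDl.
rewrite -(partnC \pi(h) N_gt0) coprimeMr -/t; apply/andP; split; last first.
  by rewrite coprime_sym /coprime gcdnMDl -/(coprime _ _) coprime_sym.
rewrite coprime_sym; apply: pnat_coprime (part_pnat _ _) _.
rewrite -coprime_pi' // ?addn_gt0 ?h_gt0 ?orbT //.
by rewrite /coprime gcdnDr -/(coprime _ _) coprimeMr co_hm.
Qed.

(** The field generated by the roots of the minimal polynomial of [x] is Galois
    over the rationals, and each element of its Galois group extends to algC. *)
Lemma Crat_aut_fixed (x : algC) :
  (forall u : {rmorphism algC -> algC}, u x = x) -> x \in Crat.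
Proof.
move=> fix_x; have [r Dr] := closed_field_poly_normal (minCpoly x).
have [p [Dp mon_p] dv_p] := minCpolyP x.
rewrite (eqP (minCpoly_monic x)) scale1r in Dr.
have [Q [QC [s Ds genQ]]] := num_field_exists r.
have Dps: map_poly (in_alg Q) p = \prod_(y <- s) ('X - y%:P).
  apply: (map_poly_inj QC); rewrite -map_poly_comp rmorph_prod /=.
  under [RHS]eq_bigr do rewrite map_polyXsubC.
  rewrite -(big_map QC predT (fun y => 'X - y%:P)) Ds -Dr Dp.
  by apply: eq_map_poly => a /=; rewrite alg_num_field fmorph_rat.
have [z sz Dz]: exists2 z, z \in s & x = QC z.
  by apply/mapP; rewrite Ds -root_prod_XsubC -Dr root_minCpoly.
have p0z: root (map_poly (in_alg Q) p) z by rewrite Dps root_prod_XsubC.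
(* [x] is a root of [p], whose irreducibility is the minimality of [minCpoly x]. *)
have Dpz: minPoly 1 z = map_poly (in_alg Q) p.
  apply/eqP; rewrite -eqp_monic ?monic_minPoly ?map_monic //; apply/andP; split.
    by apply: minPoly_dvdp => //; apply/polyOver1P; exists p.
  have /polyOver1P[q Dq] := minPolyOver 1 z.
  rewrite Dq dvdp_map -dv_p Dz.
  rewrite (_ : map_poly _ q = map_poly QC (minPoly 1 z)).
    by rewrite fmorph_root root_minPoly.
  rewrite Dq -map_poly_comp; apply: eq_map_poly => a /=.
  by rewrite alg_num_field fmorph_rat.
have splitp : splittingFieldFor 1 (minPoly 1 z) {:Q}.
  by exists s; rewrite // Dpz Dps eqpxx.
have p1 : minPoly 1 z \is a polyOver 1%VS := minPolyOver 1 z.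
have Q_ax : FieldExt_isSplittingField _ Q by constructor; exists (minPoly 1 z).
pose Q' : splittingFieldType rat := HB.pack_for (splittingFieldType rat) Q Q_ax.
have galQ : galois 1 {:Q'}.
  apply/splitting_galoisField; exists (minPoly 1 z); split=> //.
  suff: separable_element 1 z by [].
  by apply: pcharf0_separable; apply: ftrans (pchar_lalg Q) (pchar_num _).
have z1 : z \in (1%VS : {vspace Q'}).
  rewrite -(galois_fixedField galQ); apply/(fixedFieldP (memvf _)) => g _.
  have [u Du] := extend_algC_subfield_aut QC g.
  by apply: (fmorph_inj QC); rewrite Du /= -Dz fix_x.
have /vlineP[c Dc] := z1.
by rewrite Dz Dc alg_num_field fmorph_rat Crat_rat.
Qed.

(** [chi x] is a sum of [n]-th roots of unity, the eigenvalues of [x], and those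
    of [x ^+ k] are their [k]-th powers. *)
Lemma aut_char_expg (gT : finGroupType) (G : {group gT}) (chi : 'CF(G))
    (u : {rmorphism algC -> algC}) (n k : nat) (x : gT) :
    chi \is a character -> x \in G -> (#[x]%g %| n)%N ->
    (forall z : algC, z ^+ n = 1 -> u z = z ^+ k) ->
  u (chi x) = chi (x ^+ k)%g.
Proof.
move=> /char_reprP[rG ->] Gx /dvdnP[m ->] Du.
have [e [[B uB Bx] [e1 _] [-> _] _]] := repr_rsim_diag rG Gx.
rewrite cfunE groupX // mulr1n.
have ->: rG (x ^+ k)%g = invmx B *m diag_mx (\row_i (e 0 i ^+ k)) *m B.
  elim: k {Du} => [|k IHk].
    rewrite expg0 repr_mx1 (_ : \row__ _ = const_mx 1).
      by rewrite diag_const_mx mulmx1 mulVmx.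
    by apply/rowP=> i; rewrite !mxE expr0.
  rewrite expgS repr_mxM ?groupX // IHk Bx !mulmxA mulmxK //.
  rewrite -(mulmxA _ (diag_mx _) (diag_mx _)) mulmx_diag.
  by congr (_ *m diag_mx _ *m _); apply/rowP=> i; rewrite !mxE exprS.
rewrite -mulmxA mxtrace_mulC mulmxK // mxtrace_diag rmorph_sum.
by apply: eq_bigr => i _; rewrite mxE Du // mulnC exprM e1 expr1n.
Qed.

(** * Convolution by a class function *)

Section Convolution.
Variable gT : finGroupType.
Let G := [set: gT]%G.

(** This is the central character of 'chi_i at the element of the group algebra
    with coefficients [F x^-1]. *)
Definition conv_eigenvalue (F : 'CF(G)) (i : Iirr G) : algC :=
  #|G|%:R * '[F, 'chi_i] / 'chi_i 1%g.

(** Only the component of [F] along 'chi_i survives, by the generalized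
    orthogonality relation. *)
Lemma convolution_irr (F : 'CF(G)) (i : Iirr G) (y : gT) :
  \sum_x F x * 'chi_i (x^-1 * y)%g = conv_eigenvalue F i * 'chi_i y.
Proof.
transitivity
    (\sum_j '[F, 'chi_j] * \sum_(x in G) 'chi_i (x * y)%g * 'chi_j (x^-1)%g).
  rewrite (reindex_inj invg_inj) /=.
  under [RHS]eq_bigr do rewrite mulr_sumr.
  rewrite exchange_big /= [RHS](eq_bigl predT); last by move=> x; rewrite inE.
  apply: eq_bigr => x _; rewrite invgK {1}[F]cfun_sum_cfdot sum_cfunE mulr_suml.
  by apply: eq_bigr => j _; rewrite cfunE -mulrA [X in _ * X]mulrC.
rewrite (bigD1 i) //= [X in _ + X]big1 => [|j ne_ji].
  have := generalized_orthogonality_relation y i i.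
  rewrite eqxx mul1r => /(canRL (mulKf (invr_neq0 (neq0CG G)))) ->.
  by rewrite invrK addr0 /conv_eigenvalue; ring.
have := generalized_orthogonality_relation y i j.
rewrite eq_sym (negPf ne_ji) mul0r => /(canRL (mulKf (invr_neq0 (neq0CG G)))) ->.
by rewrite !mulr0.
Qed.

(** Grouped by conjugacy classes, the eigenvalue is a combination, with
    coefficients the values of [F], of the algebraic integers
    #|x ^: G| * 'chi_i x / 'chi_i 1. *)
Lemma Aint_conv_eigenvalue (F : 'CF(G)) i :
  (forall x, F x \in Aint) -> conv_eigenvalue F i \in Aint.
Proof.
move=> F_int; rewrite /conv_eigenvalue cfdotE mulrA mulfV ?neq0CG // mul1r.
rewrite sum_by_classes => [|x y Gx Gy]; last by rewrite !cfunJ.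
rewrite mulr_suml rpred_sum // => xG /repr_classesP[Gx DxG].
rewrite mulrCA -mulrA rpredM ?F_int //.
rewrite -irr_inv [_ * _ / _](_ : _ =
    #|(repr xG)^-1 ^: G|%:R * 'chi_i (repr xG)^-1%g / 'chi_i 1%g).
  by rewrite Aint_class_div_irr1 ?groupV.
by rewrite classVg card_invg -DxG.
Qed.

(** The characters themselves are eigenvectors. Conversely, if [phi] is an
    eigenvector then so is each nonzero convolution of [phi] with some 'chi_i,
    for the same eigenvalue, which must then be that of 'chi_i; and these
    convolutions cannot all vanish, since weighted by 'chi_i 1 they add up to
    the convolution with the regular character, that is, to #|G| * phi. *)
Lemma eigenvalue_convolution (F : 'CF(G)) (a : algC) :
  eigenvalue (\matrix_(i, j) F (enum_val j * (enum_val i)^-1)%g : 'M_#|gT|) a <->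
  exists i, a = conv_eigenvalue F i.
Proof.
split=> [/eigenvalueP[v Dv nz_v] | [i ->]].
  pose phi x := v 0 (enum_rank x).
  have Dphi y : \sum_x phi x * F (y * x^-1)%g = a * phi y.
    have /(congr1 (fun w : 'rV_#|gT| => w 0 (enum_rank y))) := Dv.
    rewrite !mxE => <-; rewrite [RHS](reindex _ (onW_bij _ (@enum_rank_bij gT))).
    by apply: eq_bigr => x _; rewrite mxE !enum_rankK.
  pose psi i w := \sum_x phi x * 'chi[G]_i (x^-1 * w)%g.
  have [w nz_w] : exists w, phi w != 0.
    have [j nz_j] := rV0Pn _ nz_v.
    by exists (enum_val j); rewrite /phi enum_valK.
  have : \sum_i 'chi[G]_i 1%g * psi i w != 0.
    suffices ->: \sum_i 'chi[G]_i 1%g * psi i w = #|G|%:R * phi w.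
      by rewrite mulf_neq0 ?neq0CG.
    have regE c x :
        \sum_i 'chi[G]_i 1%g * (c * 'chi_i x) = c * (#|G|%:R *+ (x == 1%g)).
      rewrite -cfRegE cfReg_sum sum_cfunE mulr_sumr.
      by apply: eq_bigr => i _; rewrite cfunE mulrCA.
    under eq_bigr do rewrite mulr_sumr.
    rewrite exchange_big /=; under eq_bigr do rewrite regE.
    rewrite (bigD1 w) //= big1 => [|x ne_xw].
      by rewrite mulVg eqxx mulr1n addr0 mulrC.
    by rewrite -eq_mulVg1 (negPf ne_xw) mulr0.
  have [i nz_i _ | psi0] := pickP (fun i => psi i w != 0); last first.
    by rewrite big1 ?eqxx // => i _; have /negbFE/eqP-> := psi0 i; rewrite mulr0.
  exists i; apply: (mulIf nz_i); rewrite /psi !mulr_sumr.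
  transitivity (\sum_y (\sum_x phi x * F (y * x^-1)%g) * 'chi[G]_i (y^-1 * w)%g).
    by apply: eq_bigr => y _; rewrite Dphi mulrA.
  under eq_bigr do rewrite mulr_suml.
  rewrite exchange_big; apply: eq_bigr => x _ /=.
  (* Conjugation by [x^-1] turns ['chi_i (x^-1 * w)] into ['chi_i (w * x^-1)]. *)
  rewrite mulrCA -(cfunJ _ _ (in_setT x^-1%g)) conjgE invgK mulgA mulVKg.
  rewrite -convolution_irr mulr_sumr (reindex_inj (mulIg x)); apply: eq_bigr => s _.
  rewrite mulgK invMg -mulrA -(cfunJ _ (x^-1 * _ * w)%g (in_setT x^-1%g)).
  by rewrite conjgE invgK !mulgA mulgV mul1g.
apply/eigenvalueP; exists (\row_j 'chi_i (enum_val j)).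
  apply/rowP=> j; rewrite !mxE -convolution_irr.
  rewrite (reindex _ (onW_bij _ (@enum_rank_bij gT))) /=.
  rewrite (reindex_inj (mulIg (enum_val j))) (reindex_inj invg_inj) /=.
  apply: eq_bigr => x _; rewrite !mxE !enum_rankK mulrC.
  by rewrite invMg invgK mulKVg.
apply/rV0Pn; exists (enum_rank 1%g).
by rewrite mxE enum_rankK irr1_neq0.
Qed.

Lemma inj_expg k : coprime k #|G| -> injective (fun x : gT => x ^+ k)%g.
Proof.
rewrite coprime_sym => co_k x y /(congr1 (fun z => z ^+ expg_invn G k)%g).
by rewrite !expgK ?inE.
Qed.

(** Applying [u] to the expansion of [F x] over the irreducible characters turns
    ['chi_i x] into ['chi_i (x ^+ k)] and each component into its image by [u].
    So u (F x) = F (x ^+ k) for all [x] as soon as [u] fixes the components, or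
    equivalently the eigenvalues; conversely the change of variable
    [x |-> x ^+ k] in the inner products shows that [u] fixes the eigenvalues.
    Algebraic integers fixed by every [u] are integers. *)
Lemma conv_eigenvalue_intP (F : 'CF(G)) (N : nat) :
    (0 < N)%N -> (#|G| %| N)%N -> (forall x, F x \in Aint) ->
  (forall i, conv_eigenvalue F i \in Num.int) <->
  (forall (u : {rmorphism algC -> algC}) (k : nat), coprime k N ->
     (forall z : algC, z ^+ N = 1 -> u z = z ^+ k) ->
   forall x, F (x ^+ k)%g = u (F x)).
Proof.
move=> N_gt0 dv_GN F_int.
have dv_N x : (#[x]%g %| N)%N := dvdn_trans (order_dvdG (in_setT x : x \in G)) dv_GN.
split=> [lam_int u k co_kN Du x | FX i].
  rewrite [F in RHS]cfun_sum_cfdot [F in LHS]cfun_sum_cfdot !sum_cfunE rmorph_sum.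
  apply: eq_bigr => i _; rewrite !cfunE rmorphM /=.
  rewrite (aut_char_expg (irr_char i) (in_setT x) (dv_N x) Du); congr (_ * _).
  have -> : '[F, 'chi_i] = conv_eigenvalue F i * 'chi_i 1%g / #|G|%:R.
    by rewrite /conv_eigenvalue divfK ?irr1_neq0 // mulrC mulKf ?neq0CG.
  have /intrP[m ->] := lam_int i; rewrite aut_Crat // irr1_degree.
  by rewrite rpred_div ?rpredM ?rpred_nat ?rpred_int.
apply: Cint_rat_Aint (Aint_conv_eigenvalue i F_int); apply: Crat_aut_fixed => u.
have [w prim_w] := C_prim_root_exists N_gt0.
have [k co_kN Dw] := aut_prim_rootP u prim_w.
have Du z : z ^+ N = 1 -> u z = z ^+ k.
  by case/(prim_rootP prim_w) => j ->; rewrite rmorphXn Dw exprAC.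
rewrite /conv_eigenvalue cfdotE irr1_degree.
rewrite !rmorphM !fmorphV !rmorph_nat rmorph_sum.
congr (_ * (_ * _) / _).
have inj_k : injective (fun x : gT => x ^+ k)%g := inj_expg (coprime_dvdr dv_GN co_kN).
rewrite [RHS](reindex_inj inj_k); apply: eq_big => [x | x _]; first by rewrite !inE.
rewrite rmorphM (FX u k co_kN Du) -!irr_inv -expgVn; congr (_ * _).
by rewrite (aut_char_expg (irr_char i) _ (dv_N _) Du) ?inE.
Qed.

End Convolution.

(** * The Boolean algebra generated by the subgroups *)

Section BooleanAlgebra.
Variable gT : finGroupType.
Implicit Types (A B : {set gT}) (x y : gT).

Lemma in_boolean_algebra_bigcup (I : finType) (P : pred I) (B : I -> {set gT}) :
    (forall i, P i -> in_boolean_algebra (B i)) ->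
  in_boolean_algebra (\bigcup_(i | P i) B i).
Proof.
move=> BA; elim/big_rec: _ => [|i A Pi BA_A]; last exact: BA_setU (BA i Pi) BA_A.
rewrite -(setICr [set: gT]); apply: BA_setI; last apply: BA_setC;
  exact: (BA_subgroup [set: gT]%G).
Qed.

(** The atoms of the Boolean algebra are the sets of generators of the cyclic
    subgroups: such a set is the subgroup minus its proper cyclic subgroups. *)
Lemma in_boolean_algebraP A :
  in_boolean_algebra A <->
  (forall x y, <[x]>%g = <[y]>%g -> x \in A -> y \in A).
Proof.
split=> [BA_A x y Dxy | cycA].
  suffices -> : (x \in A) = (y \in A) by [].
  elim: BA_A => {A} [H | A B _ IHA _ IHB | A B _ IHA _ IHB | A _ IHA].
  - by rewrite -!cycle_subG Dxy.
  - by rewrite !inE IHA IHB.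
  - by rewrite !inE IHA IHB.
  by rewrite !inE IHA.
pose gens x := <[x]>%g :&: ~: \bigcup_(y | (<[y]> \proper <[x]>)%g) <[y]>%g.
have mem_gens x y : (y \in gens x) = (<[x]>%g == <[y]>%g).
  rewrite !inE; apply/andP/eqP => [[x_y] | Dxy].
    apply: contraNeq => ne_xy; apply/bigcupP; exists y; last exact: cycle_id.
    by rewrite properEneq cycle_subG x_y eq_sym ne_xy.
  rewrite Dxy cycle_id; split=> //; apply/bigcupP=> -[z z_y].
  by rewrite -cycle_subG => /(proper_sub_trans z_y); rewrite properxx.
suffices -> : A = \bigcup_(x in A) gens x.
  apply: in_boolean_algebra_bigcup => x _; apply: BA_setI; first exact: BA_subgroup.
  by apply/BA_setC/in_boolean_algebra_bigcup => y _; apply: BA_subgroup.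
apply/setP=> y; apply/idP/bigcupP => [Ay | [x Ax]].
  by exists y; rewrite ?mem_gens.
by rewrite mem_gens => /eqP/cycA; apply.
Qed.

End BooleanAlgebra.

(** * Stability under power maps *)

Section PowerStability.
Variable gT : finGroupType.
Implicit Types (S : {set gT}) (x y : gT).
Local Notation N := (4 * #|[set: gT]|)%N.

Lemma modulus_gt0 : (0 < N)%N.
Proof. by rewrite muln_gt0 cardG_gt0. Qed.

Lemma expg_modulus x : (x ^+ N = 1)%g.
Proof. by rewrite mulnC expgM expg_cardG ?inE ?expg1n. Qed.

(** Up to inversion every exponent prime to [N] is 1 modulo 4: multiplying the
    exponent by [-1], represented by [N.-1], exchanges the two odd residues. *)
Lemma odd_power_mod4 k : coprime k N ->
  k = 1 %[mod 4] \/
  (k %% 4 = 3)%N /\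
  exists k', [/\ coprime k' N, k' = 1 %[mod 4] & forall x, (x ^+ k = x^-1 ^+ k')%g].
Proof.
move=> co_kN.
have : (k %% 4)%N \in [:: 1%N; 3%N].
  have: coprime (k %% 4) 4 by rewrite coprime_modl (coprime_dvdr _ co_kN) ?dvdn_mulr.
  by case: (k %% 4)%N (ltn_pmod k (isT : 0 < 4)%N) => [|[|[|[|]]]].
rewrite !inE => /orP[] /eqP k_mod4; [by left | right; split=> //].
exists (N.-1 * k)%N; split.
- by rewrite coprimeMl co_kN coprime_sym coprimenP ?modulus_gt0.
- have N1 : (N.-1 %% 4 = 3)%N.
    case: #|_| (cardG_gt0 [set: gT]) => // n _.
    by rewrite mulnS addSn /= addnC mulnC modnMDl.
  by rewrite -modnMm N1 k_mod4.
move=> x; rewrite expgM; congr (_ ^+ k)%g; apply: (mulIg x^-1%g).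
by rewrite mulgV -expgSr (prednK modulus_gt0) expg_modulus.
Qed.

(** The entry of the adjacency matrix at [u], [v] is the value at [v * u^-1]. *)
Definition connection S x : algC := hermitian_entry (cayley_edge S) 1%g x.

Lemma connectionE S x :
  connection S x = if x \in S then if x^-1%g \in S then 1 else 'i
                   else if x^-1%g \in S then - 'i else 0.
Proof.
rewrite /connection /hermitian_entry /cayley_edge invg1 mulg1 mul1g.
by case: (x \in S); case: (x^-1%g \in S).
Qed.

(** [S] can be recovered from the connection values: the sum of the real and
    imaginary parts is 1 at 1 and 'i, -1 at -'i and 0 at 0. *)
Lemma mem_connection S x :
  (x \in S) = (0 < 'Re (connection S x) + 'Im (connection S x)).
Proof.
rewrite connectionE; case: ifP => _; case: ifP => _.
- by rewrite (Creal_ReP _ _) ?(Creal_ImP _ _) ?addr0 ?ltr01 ?rpred1.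
- by rewrite Re_i Im_i add0r ltr01.
- by rewrite !raddfN /= Re_i Im_i oppr0 add0r oppr_gt0 ltr10.
by rewrite !raddf0 addr0 ltxx.
Qed.

Lemma connectionV S x : connection S x^-1 = (connection S x)^*.
Proof.
rewrite !connectionE invgK; case: ifP => _; case: ifP => _.
- by rewrite rmorph1.
- by rewrite rmorphN /= conjCi opprK.
- by rewrite conjCi.
by rewrite rmorph0.
Qed.

Definition power_stable S :=
  forall k, coprime k N -> k = 1 %[mod 4] -> forall x, (x ^+ k \in S)%g = (x \in S).

Lemma exprCi_mod4 k : 'i ^+ k = 'i ^+ (k %% 4) :> algC.
Proof.
rewrite {1}(divn_eq k 4) exprD mulnC exprM (exprM _ 2 2) sqrCi sqrrN.
by rewrite !expr1n mul1r.
Qed.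

(** An exponent k = 1 modulo 4 comes from an automorphism fixing 'i, hence all
    the connection values. When k = 3 modulo 4 the automorphism conjugates these
    values, which amounts to inverting [x]. *)
Lemma power_stable_connection S :
  (forall (u : {rmorphism algC -> algC}) (k : nat), coprime k N ->
     (forall z : algC, z ^+ N = 1 -> u z = z ^+ k) ->
   forall x, connection S (x ^+ k)%g = u (connection S x)) <->
  power_stable S.
Proof.
have iN1 : 'i ^+ N = 1 :> algC by rewrite exprCi_mod4 modnMr expr0.
split=> [fu k co_kN k1 x | stabS u k co_kN Du x].
  have [u Du] := Qn_aut_exists co_kN.
  have ui : u 'i = 'i by rewrite Du // exprCi_mod4 k1.
  rewrite !mem_connection (fu u k co_kN Du) connectionE.
  by do 2!case: ifP => _; rewrite ?rmorphN ?rmorph0 ?rmorph1 /= ?ui.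
have stab_conn j y :
    coprime j N -> j = 1 %[mod 4] -> connection S (y ^+ j) = connection S y.
  by move=> co_j j1; rewrite !connectionE -expgVn !stabS.
have [k1 | [k3 [k' [co_k' k'1 Dk']]]] := odd_power_mod4 co_kN.
  rewrite stab_conn // connectionE.
  have ui : u 'i = 'i by rewrite Du // exprCi_mod4 k1.
  by do 2!case: ifP => _; rewrite ?rmorphN ?rmorph0 ?rmorph1 /= ?ui.
rewrite Dk' stab_conn // connectionV connectionE.
have ui : u 'i = - 'i by rewrite Du // exprCi_mod4 k3 exprS sqrCi mulrN1.
by do 2!case: ifP => _; rewrite ?rmorphN ?rmorph0 ?rmorph1 /= ?ui ?conjCi.
Qed.

Lemma order_dvd_modulus x : (#[x]%g %| N)%N.
Proof. by rewrite dvdn_mull // order_dvdG ?inE. Qed.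

Lemma expgz_modz_order x (k : int) : expgz x k = (x ^+ `|(k %% #[x]%g)%Z|)%g.
Proof.
have m_neq0 : #[x]%g%:Z != 0 by rewrite eqz_nat -lt0n order_gt0.
case: k => n /=; first by rewrite modz_nat /= expg_mod_order.
apply: (mulIg (x ^+ n.+1)%g); rewrite mulVg -expgD.
apply/esym/eqP; rewrite -order_dvdn.
have -> : (#[x]%g %| (`|(Negz n %% #[x]%g)%Z| + n.+1))%N
        = (#[x]%g%:Z %| (Negz n %% #[x]%g)%Z + n.+1%:Z)%Z.
  by rewrite -{2}(gez0_abs (modz_ge0 _ m_neq0)).
apply/dvdzP; exists (- (Negz n %/ #[x]%g)%Z); apply/eqP.
by rewrite -subr_eq0 mulNr opprK addrAC [(_ %% _)%Z + _]addrC -divz_eq NegzE addNr.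
Qed.

Lemma order_expg_coprime x k : coprime k N -> #[(x ^+ k)%g]%g = #[x]%g.
Proof.
move=> co_kN; have := coprime_dvdr (order_dvd_modulus x) co_kN.
by rewrite orderXgcd coprime_sym => /eqnP->; rewrite divn1.
Qed.

(** As #[x] is a multiple of 4, both conditions on the exponent of [approx4]
    depend only on its residue modulo #[x], which lifts to one prime to [N]. *)
Lemma approx4P x y :
  approx4 x y <->
  x \in Gamma4 gT /\ exists k, [/\ coprime k N, k = 1 %[mod 4] & y = (x ^+ k)%g].
Proof.
split=> [[G4x _ [k [-> co_kx k1]]] | [G4x [k [co_kN k1 ->]]]].
  split=> //; rewrite inE in G4x; set m := #[x]%g in co_kx G4x *.
  have m_neq0 : m%:Z != 0 by rewrite eqz_nat -lt0n order_gt0.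
  pose j := `|(k %% m)%Z|%N.
  have Dj : j%:Z = (k %% m)%Z by rewrite /j gez0_abs ?modz_ge0.
  have j1 : j = 1 %[mod 4].
    apply/eqP; rewrite -eqz_nat -!modz_nat Dj; apply/eqP.
    have /dvdnP[q Dq] := G4x.
    by move: k1; rewrite {1}(divz_eq k m) {2}Dq PoszM mulrA modzMDl.
  have co_jm : coprime j m.
    have : gcdz (k %% m)%Z m%:Z = 1 by rewrite gcdz_modl.
    by rewrite -Dj => -[] /eqP.
  have [k' co_k' Dk'] := coprime_lift modulus_gt0 co_jm.
  exists k'; split=> //.
    by rewrite -(modn_dvdm k' G4x) Dk' modn_dvdm.
  by rewrite expgz_modz_order -[RHS]expg_mod_order Dk' expg_mod_order.
split=> //; first by move: G4x; rewrite !inE order_expg_coprime.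
exists k%:Z; split=> //.
  by apply/eqP; rewrite eqz_nat; apply: coprime_dvdr co_kN; apply: order_dvd_modulus.
by rewrite !modz_nat k1.
Qed.

(** If 4 does not divide #[x], the congruences k = 1 modulo 4 and k = -1 modulo
    #[x] are compatible, since 1 = -1 modulo gcd(4, #[x]), which is 1 or 2. *)
Lemma inverse_exponent x : ~~ (4 %| #[x]%g)%N ->
  exists k, [/\ coprime k N, k = 1 %[mod 4] & (x ^+ k = x^-1)%g].
Proof.
set m := #[x]%g => ndv4m; have m_gt0 : (0 < m)%N := order_gt0 x.
have [j [j1 mj]] : exists j, j = 1 %[mod 4] /\ (m %| j.+1)%N.
  have [m_odd | m_even] := boolP (odd m).
    exists m.*2.-1; rewrite prednK ?double_gt0 // -muln2 dvdn_mulr //.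
    by split=> //; lia.
  by exists m.-1; rewrite prednK //; split=> //; lia.
have co_j : coprime j (4 * m).
  have co_jS : coprime j j.+1 by rewrite coprimenS.
  by rewrite coprimeMr (coprime_dvdr mj) // andbT -coprime_modl j1.
have [k co_kN Dk] := coprime_lift modulus_gt0 co_j.
exists k; split=> //.
  by rewrite -(modn_dvdm k (dvdn_mulr m (dvdnn 4))) Dk modn_dvdm ?dvdn_mulr.
have Dkm : k = j %[mod m].
  by rewrite -(modn_dvdm k (dvdn_mull 4 (dvdnn m))) Dk modn_dvdm ?dvdn_mull.
rewrite -expg_mod_order -/m Dkm expg_mod_order.
by apply/eqP; rewrite eq_sym eq_invg_mul -expgS -order_dvdn.
Qed.

(** The inverse-closed part of a stable [S] is stable under all exponents prime
    to [N], since [odd_power_mod4] trades k = 3 modulo 4 for an inversion, and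
    these exponents reach all the generators of each cyclic subgroup. The
    oriented part is a union of orbits, by [approx4P], and avoids the elements
    that [inverse_exponent] inverts. *)
Lemma power_stableP S :
  power_stable S <->
  in_boolean_algebra (S :\: oriented_part S) /\ in_D (oriented_part S).
Proof.
have mem_sym x : (x \in S :\: oriented_part S) = (x \in S) && (x^-1%g \in S).
  by rewrite !inE; case: (x \in S); rewrite /= ?andbF ?negbK ?andbT.
split=> [stabS | [/in_boolean_algebraP BA [_ [X X4 DX]]]].
  split; last split.
  - apply/in_boolean_algebraP => x y Dxy; rewrite !mem_sym => /andP[Sx Sx'].
    have /cycleP[j Dy] : y \in <[x]>%g by rewrite Dxy cycle_id.
    have := generator_coprime x j; rewrite -Dy /generator Dxy eqxx => /esym.
    rewrite coprime_sym => co_jx.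
    have [k co_kN Dk] := coprime_lift modulus_gt0 co_jx.
    have {j Dy co_jx Dk} -> : y = (x ^+ k)%g.
      by rewrite -expg_mod_order Dk expg_mod_order.
    rewrite -expgVn; have [k1 | [_ [k' [co_k' k'1 Dk']]]] := odd_power_mod4 co_kN.
      by rewrite !stabS // Sx.
    by rewrite !Dk' !stabS // invgK Sx Sx'.
  - by move=> x; rewrite !inE invgK => /andP[-> _]; rewrite andbF.
  have SX4 : oriented_part S \subset Gamma4 gT.
    apply/subsetP=> x; rewrite !inE => /andP[Sx Sx'].
    apply: contraR Sx' => /inverse_exponent[k [co_kN k1 <-]].
    by rewrite stabS.
  exists (oriented_part S) => // y; split=> [Sy | [x]]; last first.
    rewrite inE => /andP[Sx Sx'] /approx4P[_ [k [co_kN k1 ->]]].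
    by rewrite inE -expgVn !stabS // Sx.
  exists y => //; apply/approx4P; split; first exact: (subsetP SX4).
  by exists 1%N; rewrite coprime1n expg1.
move=> k co_kN k1.
have subS x : x \in S -> (x ^+ k \in S)%g.
  move=> Sx; have [Sx' | Sx'] := boolP (x^-1%g \in S).
    suffices : (x ^+ k)%g \in S :\: oriented_part S by rewrite inE => /andP[].
    apply: BA (_ : x \in _); last by rewrite mem_sym Sx.
    apply/eqP; rewrite -/(generator _ _) generator_coprime coprime_sym.
    exact: coprime_dvdr (order_dvd_modulus x) co_kN.
  have /DX[z Xz /approx4P[z4 [j [co_jN j1 Dx]]]] : x \in oriented_part S.
    by rewrite inE Sx.
  suffices : (x ^+ k)%g \in oriented_part S by rewrite inE => /andP[].
  apply/DX; exists z => //; apply/approx4P; split=> //.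
  exists (j * k)%N; rewrite coprimeMl co_jN co_kN Dx expgM; split=> //.
  by rewrite -modnMm j1 k1.
have inj_k : injective (fun x : gT => x ^+ k)%g.
  by apply/inj_expg/(coprime_dvdr _ co_kN)/dvdn_mull.
(* An injective map that sends a finite set into itself permutes it. *)
have imS : [set (x ^+ k)%g | x in S] = S.
  apply/eqP; rewrite eqEcard card_imset // leqnn andbT.
  by apply/subsetP=> _ /imsetP[x Sx ->]; apply: subS.
by move=> x; rewrite -{1}imS (mem_imset _ _ inj_k).
Qed.

End PowerStability.

Theorem theorem3p3 (gT : finGroupType) (S : {set gT})
    (S_no1 : 1%g \notin S) (S_normal : union_of_conjugacy_classes S) :
  H_integral (cayley_edge S) <->
  in_boolean_algebra (S :\: oriented_part S) /\ in_D (oriented_part S).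
Proof.
have subJ x y : x \in S -> (x ^ y)%g \in S.
  have [X ->] := S_normal; case/bigcupP=> z Xz /imsetP[g _ ->].
  by apply/bigcupP; exists z; rewrite // -conjgM memJ_class ?inE.
have memJ x y : ((x ^ y)%g \in S) = (x \in S).
  by apply/idP/idP=> [/(subJ _ y^-1%g) | /subJ//]; rewrite conjgK.
have connJ : is_class_fun <<[set: gT]>>%g (finfun (connection S)).
  apply: intro_class_fun => [x y _ _ | x]; last by rewrite mem_gen ?inE.
  by rewrite !connectionE -conjVg !memJ.
pose F : 'CF([set: gT]) := Cfun 0 connJ.
have DF x : F x = connection S x by rewrite cfunE.
have DH : hermitian_adjacency (cayley_edge S)
        = \matrix_(i, j) F (enum_val j * (enum_val i)^-1)%g.
  apply/matrixP=> i j; rewrite !mxE DF /connection /hermitian_entry /cayley_edge.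
  by rewrite invg1 mulg1 mul1g invMg invgK.
have F_int x : F x \in Aint.
  have Aint_i : 'i \in Aint.
    by apply: (@Aint_unity_root 4) => //; apply/unity_rootP; rewrite exprCi_mod4.
  by rewrite DF connectionE; do 2!case: ifP => _; rewrite ?rpredN ?rpred0 ?rpred1.
rewrite -power_stableP -power_stable_connection.
rewrite (_ : H_integral _ <-> forall i, conv_eigenvalue F i \in Num.int); last first.
  rewrite /H_integral DH; split=> [H i | H a /eigenvalue_convolution[i ->] //].
  by apply/H/eigenvalue_convolution; exists i.
rewrite (conv_eigenvalue_intP (modulus_gt0 gT) _ F_int) ?dvdn_mull //.
by split=> H u k co_k Du x; have := H u k co_k Du x; rewrite !DF.
Qed.
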